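(* For any $\mathcal L_{\mathsf{pf}}$-formula $A$, the following are equivalent: (1) $\mathbf{PF}\vdash A$; (2) $A$ is valid on all $\mathbf{PF}$-frames; (3) $A$ is valid on all finite rooted nice PBA $\mathbf{PF}$-frames; (4) for every Kripke model $\mathcal M$ based on a finite rooted nice PBA $\mathbf{PF}$-frame, $A$ is true at every $\preccurlyeq$-root element of the $\sqsubset$-root cluster of $\mathcal M$.
   Context: $\mathcal L_{\mathsf{pf}}$ is the bimodal propositional language with modal operators $\Box_{\mathsf p},\Box_{\mathsf f}$ ($\Diamond_{\mathsf p}=\neg\Box_{\mathsf p}\neg$, $\Diamond_{\mathsf f}=\neg\Box_{\mathsf f}\neg$). The logic $\mathbf{PF}$ has axioms: all propositional tautologies; $\Box_{\mathsf p}(A\to B)\to(\Box_{\mathsf p}A\to\Box_{\mathsf p}B)$; $\Box_{\mathsf p}(\Box_{\mathsf p}A\to A)\to\Box_{\mathsf p}A$; $\Box_{\mathsf f}(A\to B)\to(\Box_{\mathsf f}A\to\Box_{\mathsf f}B)$; $\Box_{\mathsf f}A\to A$; $\Box_{\mathsf f}A\to\Box_{\mathsf f}\Box_{\mathsf f}A$; $\Diamond_{\mathsf f}\Box_{\mathsf f}A\to\Box_{\mathsf f}\Diamond_{\mathsf f}A$; $\Box_{\mathsf p}A\to\Box_{\mathsf f}\Box_{\mathsf p}A$; $\Diamond_{\mathsf p}A\to\Box_{\mathsf f}\Diamond_{\mathsf p}A$; $\Box_{\mathsf p}A\to\Box_{\mathsf p}\Box_{\mathsf f}A$; rules: modus ponens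 and necessitation for each of $\Box_{\mathsf p},\Box_{\mathsf f}$. A Kripke frame is $(W,\sqsubset,\preccurlyeq)$ with $W\neq\emptyset$ and binary relations $\sqsubset$ (for $\Box_{\mathsf p}$) and $\preccurlyeq$ (for $\Box_{\mathsf f}$); in a model, $x\Vdash\Box_{\mathsf p}B$ iff $y\Vdash B$ for all $y$ with $x\sqsubset y$, and $x\Vdash\Box_{\mathsf f}B$ iff $y\Vdash B$ for all $y$ with $x\preccurlyeq y$. A formula is valid on a frame if true at every point of every model on it. A $\mathbf{PF}$-frame is a frame on which all theorems of $\mathbf{PF}$ are valid. For a $\mathbf{PF}$-frame, let $\sim$ be the symmetric closure of $\preccurlyeq$ and $\sim^+$ its transitive closure; the $\sim^+$-equivalence classes are called clusters, $\mathcal C_x$ denoting the cluster of $x$. A $\mathbf{PF}$-frame is nice if for all $x,y,z$: $x\sqsubset z$ and $y\preccurlyeq z$ imply $x\sqsubset y$; in a nice frame one writes $\mathcal C_x\sqsubset\mathcal C_y$ iff $x\sqsubset y$ (well defined). A nice $\mathbf{PF}$-frame is rooted if (i) there is $r$ with, for every $x$, either $\mathcal C_r=\mathcal C_x$ or $\mathcal C_r\sqsubset\mathcal C_x$ ($\mathcal C_r$ is the $\sqsubset$-root cluster), and (ii) every cluster $\mathcal C$ has a $\preccurlyeq$-root element, i.e. some $x\in\mathcal C$ with $x\preccurlyeq y$ for all $y\in\mathcal C$. It is PBA if moreover each $(\mathcal C,\preccurlyeq)$ is a pre-Boolean algebra: letting $x\approx y$ iff $x\preccurlyeq y$ and $y\preccurlyeq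 x$, the quotient $(\mathcal C/{\approx},\preccurlyeq)$ is a Boolean algebra. *)

(* Defs.v *)
From Stdlib Require Import Relation_Operators.
From mathcomp Require Import all_boot all_order.
From mathcomp Require Import boolp classical_sets functions cardinality.

Set Implicit Arguments.
Unset Strict Implicit.
Unset Printing Implicit Defensive.

Local Open Scope classical_set_scope.

Inductive form : Type :=
  | Var of nat
  | Bot
  | Imp of form & form
  | BoxP of form
  | BoxF of form.

Definition Neg (A : form) : form := Imp A Bot.
Definition DiaP (A : form) : form := Neg (BoxP (Neg A)).
Definition DiaF (A : form) : form := Neg (BoxF (Neg A)).

(* Boxed formulas are treated as additional propositional atoms. *)
Fixpoint prop_eval (v : form -> bool) (A : form) : bool :=
  match A with
  | Bot => false
  | Imp B C => prop_eval v B ==> prop_eval v C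
  | Var _ | BoxP _ | BoxF _ => v A
  end.

Definition tautology (A : form) : Prop := forall v, prop_eval v A.

Inductive PF : form -> Prop :=
  | PF_taut A : tautology A -> PF A
  | PF_P_K A B :
      PF (Imp (BoxP (Imp A B)) (Imp (BoxP A) (BoxP B)))
  | PF_P_Loeb A :
      PF (Imp (BoxP (Imp (BoxP A) A)) (BoxP A))
  | PF_F_K A B :
      PF (Imp (BoxF (Imp A B)) (Imp (BoxF A) (BoxF B)))
  | PF_F_T A : PF (Imp (BoxF A) A)
  | PF_F_4 A : PF (Imp (BoxF A) (BoxF (BoxF A)))
  | PF_F_2 A : PF (Imp (DiaF (BoxF A)) (BoxF (DiaF A)))
  | PF_BoxP_FP A : PF (Imp (BoxP A) (BoxF (BoxP A)))
  | PF_DiaP_FP A : PF (Imp (DiaP A) (BoxF (DiaP A)))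
  | PF_BoxP_PF A : PF (Imp (BoxP A) (BoxP (BoxF A)))
  | PF_MP A B : PF (Imp A B) -> PF A -> PF B
  | PF_NecP A : PF A -> PF (BoxP A)
  | PF_NecF A : PF A -> PF (BoxF A).

Record frame : Type := Frame {
  world : Type;
  relP : world -> world -> Prop;
  relF : world -> world -> Prop;
  world_inhabited : inhabited world
}.

Definition valuation (F : frame) : Type := nat -> set (world F).

Fixpoint forces (F : frame) (V : valuation F) (x : world F) (A : form) : Prop :=
  match A with
  | Var p => V p x
  | Bot => False
  | Imp B C => forces V x B -> forces V x C
  | BoxP B => forall y, relP x y -> forces V y B
  | BoxF B => forall y, relF x y -> forces V y B
  end.

Definition valid (F : frame) (A : form) : Prop :=
  forall (V : valuation F) (x : world F), forces V x A.

Definition PF_frame (F : frame) : Prop := forall A, PF A -> valid F A.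

Definition finite_frame (F : frame) : Prop := finite_set [set: world F].

Section Clusters.
Variable F : frame.
Implicit Types (x y z r : world F) (C D X Y : set (world F)).

Definition simF x y : Prop := relF x y \/ relF y x.

Definition cluster x : set (world F) :=
  [set y | clos_trans (world F) simF x y].

Definition is_cluster C : Prop := exists x, C = cluster x.

Definition nice : Prop :=
  forall x y z, relP x z -> relF y z -> relP x y.

(* On nice PF-frames this does not depend on the representatives:
   see [cluster_relPE] below. *)
Definition cluster_relP C D : Prop :=
  exists x y, [/\ C = cluster x, D = cluster y & relP x y].

Definition root_cluster C : Prop :=
  is_cluster C /\ forall D, is_cluster D -> C = D \/ cluster_relP C D.

Definition root_element C x : Prop :=
  C x /\ forall y, C y -> relF x y.

Definition rooted : Prop :=
  (exists C, root_cluster C) /\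
  (forall C, is_cluster C -> exists x, root_element C x).

Definition approx x y : Prop := relF x y /\ relF y x.

Definition approx_class C x : set (world F) := [set y | C y /\ approx x y].

Definition approx_quotient C : set (set (world F)) :=
  [set approx_class C x | x in C].

Definition quotient_le X Y : Prop :=
  exists x y, [/\ X x, Y y & relF x y].

End Clusters.

(* The set [S] ordered by [le] is order-isomorphic to a MathComp Boolean
   algebra (complemented bounded distributive lattice); the one-element
   algebra is included. *)
Definition boolean_algebra (T : Type) (S : set T) (le : T -> T -> Prop) : Prop :=
  exists (d : Order.disp_t) (B : ctbDistrLatticeType d) (f : T -> B),
    set_bij S [set: B] f /\
    forall X Y, S X -> S Y -> (le X Y <-> (f X <= f Y)%O).

Definition pre_boolean_algebra (F : frame) (C : set (world F)) : Prop :=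
  boolean_algebra (approx_quotient C) (@quotient_le F).

Definition PBA (F : frame) : Prop :=
  forall C : set (world F), is_cluster C -> pre_boolean_algebra C.

Definition finite_rooted_nice_PBA_PF_frame (F : frame) : Prop :=
  [/\ PF_frame F, finite_frame F, nice F, rooted F & PBA F].

Section Facts.
Variable F : frame.
Hypothesis FP : PF_frame F.
Implicit Types x y z : world F.

Lemma PF_frame_reflF x : relF x x.
Proof.
exact: (FP (PF_F_T (Var 0)) (fun _ => relF x) x (fun y => id)).
Qed.

Lemma PF_frame_relP_forth x y z : relF x y -> relP x z -> relP y z.
Proof.
move=> xy xz; apply: contrapT => nyz.
apply: (FP (PF_DiaP_FP (Var 0)) (fun _ => [set z]) x _ y xy) => /=.
  by move=> /(_ z xz); apply.
by move=> w yw wz; apply: nyz; rewrite -wz.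
Qed.

Lemma PF_frame_relP_back x y z : relF x y -> relP y z -> relP x z.
Proof.
move=> xy yz.
exact: (FP (PF_BoxP_FP (Var 0)) (fun _ => relP x) x (fun w => id) y xy z yz).
Qed.

Lemma PF_frame_relP_relF x y z : relP x y -> relF y z -> relP x z.
Proof.
move=> xy yz.
exact: (FP (PF_BoxP_PF (Var 0)) (fun _ => relP x) x (fun w => id) y xy z yz).
Qed.

Lemma cluster_refl x : cluster x x.
Proof. by apply: t_step; left; exact: PF_frame_reflF. Qed.

Lemma cluster_relPE x y :
  nice F -> cluster_relP (cluster x) (cluster y) <-> relP x y.
Proof.
move=> Fn; split=> [[x' [y' [xx' yy' x'y']]]|xy]; last by exists x, y.
have cl (a b : world F) : cluster a b ->
    (forall c, relP a c <-> relP b c) /\ (forall c, relP c a <-> relP c b).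
  elim=> {a b} [a b [ab|ba]|a b c _ [ab1 ab2] _ [bc1 bc2]].
  - split=> c; split=> H.
    + exact: PF_frame_relP_forth ab H.
    + exact: PF_frame_relP_back ab H.
    + exact: PF_frame_relP_relF H ab.
    + exact: Fn H ab.
  - split=> c; split=> H.
    + exact: PF_frame_relP_back ba H.
    + exact: PF_frame_relP_forth ba H.
    + exact: Fn H ba.
    + exact: PF_frame_relP_relF H ba.
  - split=> d; first by rewrite ab1.
    by rewrite ab2.
have [xx _] := cl x x' ltac:(rewrite xx'; exact: cluster_refl).
have [_ yy] := cl y y' ltac:(rewrite yy'; exact: cluster_refl).
by rewrite xx yy.
Qed.

End Facts.

(* Main.v *)
Require Import Defs.
From Stdlib Require Import Relation_Operators.
From HB Require Import structures.
From mathcomp Require Import all_boot all_order.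
From mathcomp Require Import boolp classical_sets functions cardinality.

(* For the implication from (4) to (1), suppose that [PF] does not prove [A].  Take
   the finitely many traces on a closure set of the maximal consistent theories.
   The theories [BoxF]-above a given theory [T] all contain the same [BoxP]-formulas
   and are directed by axiom (.2), so their traces form a finite preorder with a
   root and a top.  Such a preorder [W] is a p-morphic image of the pre-Boolean
   algebra of pairs (subset of [W], element of [W]): a chain is sent to its maximum
   and any other subset to the top.  One such cluster for each trace, with the
   clusters ordered by the usual strict order of Goedel-Loeb logic, gives a finite
   rooted nice PBA frame refuting [A] at the root of its root cluster. *)

Import Order.DefaultSetSubsetOrder.

Set Implicit Arguments.
Unset Strict Implicit.
Unset Printing Implicit Defensive.

(** * Covering a directed preorder by a pre-Boolean algebra *)

Section Cover.
Variables (W : finType) (le : rel W) (D : {set W}) (r t : W).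
Hypotheses (le_refl : reflexive le) (le_trans : transitive le).
Hypotheses (rD : r \in D) (tD : t \in D).
Hypotheses (r_le : {in D, forall w, le r w}) (le_t : {in D, forall w, le w t}).

Let good (X : {set W}) :=
  (X \subset D) && [forall x in X, forall y in X, le x y || le y x].

Let goodP (X : {set W}) : reflect
  ({subset X <= D} /\ {in X &, forall x y, le x y || le y x}) (good X).
Proof.
apply: (iffP andP) => -[/fintype.subsetP XD H]; split=> //.
  by move=> x y xX yX; have /forall_inP/(_ _ xX)/forall_inP/(_ _ yX) := H.
by apply/forall_inP => x xX; apply/forall_inP => y yX; exact: H.
Qed.

(* In a chain, an element with the largest down-set is a maximum. *)
Let chain_max X : good X ->
  exists2 w, w \in r |: X & {in X, forall x, le x w}.
Proof.
move=> /goodP[XD Xc].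
have [w wX wmax] := @arg_maxnP _ r (mem (r |: X)) (fun w => #|[set x | le x w]|)
  (setU11 r X).
exists w => // x xX; have xr : x \in r |: X by rewrite inE xX orbT.
have /orP[//|wx] : le x w || le w x.
  by case/setU1P: wX => [->|wX]; [rewrite r_le ?orbT ?XD|exact: Xc].
have /eqP/finset.setP/(_ x) : [set y | le y w] == [set y | le y x].
  rewrite eqEcard; apply/andP; split; last exact: wmax.
  by apply/fintype.subsetP => y; rewrite !inE => /le_trans; exact.
by rewrite !inE le_refl.
Qed.

(** Including [r], which is below all of [D], gives the empty chain a value. The default of [odflt]
    is never reached, by [chain_max]. *)
Let g (X : {set W}) : W :=
  if good X then odflt r [pick w in r |: X | [forall x in X, le x w]] else t.

Let g_good X : good X -> g X \in r |: X /\ {in X, forall x, le x (g X)}.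
Proof.
move=> gX; rewrite /g gX; case: pickP => [w /andP[wX /forall_inP]//|no].
have [w wX wmax] := chain_max gX.
by have /negP[] := no w; rewrite /= wX; apply/forall_inP.
Qed.

Let gD X : g X \in D.
Proof.
case gX: (good X); last by rewrite /g gX.
have [/setU1P[->//|gXX] _] := g_good gX.
by have /goodP[XD _] := gX; exact: XD.
Qed.

Let g_mono (X Y : {set W}) : X \subset Y -> le (g X) (g Y).
Proof.
move=> /fintype.subsetP XY; case gY: (good Y); last by rewrite [g Y]/g gY le_t.
have gX : good X.
  have /goodP[YD Yc] := gY; apply/goodP; split=> [x /XY/YD//|x y /XY xY /XY].
  exact: Yc.
have [_ Yub] := g_good gY.
by have [/setU1P[->|/XY/Yub//] _] := g_good gX; rewrite r_le.
Qed.

(** A chain whose maximum is below [v] stays a chain when [v] is added, and [v] becomes a maximum.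
    If [X] is not [good], then [v] is already equivalent to [t] and [X] itself serves. *)
Let g_back X v : v \in D -> le (g X) v ->
  exists Y : {set W}, [/\ X \subset Y, le (g Y) v & le v (g Y)].
Proof.
move=> vD; case gX: (good X); last first.
  by move=> tv; exists X; split=> //; rewrite /g gX le_t.
move=> Xv; have [_ Xub] := g_good gX; have /goodP[XD Xc] := gX.
have xv x : x \in X -> le x v by move=> /Xub /le_trans; exact.
have gY : good (v |: X).
  apply/goodP; split=> [x /setU1P[->|/XD]//|x y].
  case/setU1P=> [->|xX] /setU1P[->|yX]; rewrite ?le_refl ?xv ?orbT //.
  exact: Xc.
have [gYY Yub] := g_good gY; exists (v |: X); split; first exact: subsetU1.
  by case/setU1P: gYY => [->|/setU1P[->|/xv]//]; rewrite ?r_le.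
by apply: Yub; exact: setU11.
Qed.

(* A chain is sent to its maximum and any other subset of [W] to the top; the
   second argument selects an element of the resulting preorder class. *)
Lemma preorder_cover : exists f : {set W} -> W -> W,
  [/\ forall X u, f X u \in D,
      forall (X Y : {set W}) u v, X \subset Y -> le (f X u) (f Y v),
      forall X u v, v \in D -> le (f X u) v ->
        exists2 Y : {set W}, X \subset Y & f Y v = v
    & f finset.set0 r = r].
Proof.
(* As [f X u] is always equivalent to [g X], monotonicity passes from [g] to [f]; the argument [u]
   turns the equivalence in [g_back] into an equality. *)
pose f X u := if [&& u \in D, le u (g X) & le (g X) u] then u else g X.
have f_g X u : le (f X u) (g X) by rewrite /f; case: and3P => [[]|_].
have g_f X u : le (g X) (f X u) by rewrite /f; case: and3P => [[]|_].
exists f; split.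
- by move=> X u; rewrite /f; case: and3P => [[]|_].
- move=> X Y u v XY; apply: le_trans (g_f _ _).
  by apply: le_trans (f_g _ _) (g_mono XY).
- move=> X u v vD Xv.
  have [Y [XY Yv vY]] := g_back vD (le_trans (g_f X u) Xv).
  by exists Y => //; rewrite /f vD Yv vY.
- have g0 : good finset.set0.
    by apply/goodP; split=> [x|x y]; rewrite finset.in_set0.
  have [/setU1P[g0r|g00] _] := g_good g0; last by rewrite finset.in_set0 in g00.
  by rewrite /f g0r rD le_refl.
Qed.

End Cover.

Local Open Scope classical_set_scope.

HB.instance Definition _ := gen_eqMixin form.

(** * Maximal consistent theories *)

(** Closed under modus ponens but not under necessitation, like the set of formulas true at one
    point of a model. *)
Definition theory (T : set form) : Prop :=
  (forall A, PF A -> T A) /\ (forall A B, T (Imp A B) -> T A -> T B).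

Definition mct (T : set form) : Prop :=
  [/\ theory T, ~ T Bot & forall A, ~ T A -> T (Neg A)].

(** The canonical accessibility relation for [BoxF]. *)
Definition stepF (S T : set form) : Prop := forall A, S (BoxF A) -> T A.

Ltac PF_tauto :=
  apply: PF_taut; let v := fresh "v" in intro v; rewrite /=;
  repeat match goal with
  | |- context [prop_eval ?v ?A] => case: (prop_eval v A) => //=
  | |- context [?v ?A] => is_var v; case: (v A) => //=
  end.

Section Theory.
Variable T : set form.
Hypothesis thT : theory T.

Let thm A : PF A -> T A := thT.1 A.
Let mp A B : T (Imp A B) -> T A -> T B := thT.2 A B.

Lemma theory_rule1 A B : PF (Imp A B) -> T A -> T B.
Proof. by move=> /thm; exact: mp. Qed.

Lemma theory_rule2 A B C : PF (Imp A (Imp B C)) -> T A -> T B -> T C.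
Proof. by move=> /thm AB TA; apply: mp; exact: mp AB TA. Qed.

(** By the deduction theorem, this set is the theory generated by [T] and [A]. *)
Lemma theory_adjoin A : theory [set B | T (Imp A B)].
Proof.
split=> [B PB|B C /= AB]; first by apply: (theory_rule1 _ (thm PB)); PF_tauto.
by apply: theory_rule2 AB; PF_tauto.
Qed.

Lemma theory_unboxF : theory [set B | T (BoxF B)].
Proof.
split=> [B PB|B C /=]; first exact/thm/PF_NecF.
by apply: theory_rule2; exact: PF_F_K.
Qed.

Lemma theory_unboxP : theory [set B | T (BoxP B)].
Proof.
split=> [B PB|B C /=]; first exact/thm/PF_NecP.
by apply: theory_rule2; exact: PF_P_K.
Qed.

End Theory.

Lemma lindenbaum T : theory T -> ~ T Bot -> exists2 M, mct M & T `<=` M.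
Proof.
move=> thT cT.
pose P X := X = set0 \/ [/\ T `<=` X, theory X & ~ X Bot].
have [|M [PM Mmax]] := @Zorn_bigcup _ P.
  move=> F FP Ftot.
  have [[X FX X0]|Fe] := pselect (exists2 X, F X & X !=set0); last first.
    left; apply/seteqP; split=> // A [X FX XA]; apply: Fe.
    by exists X => //; exists A.
  have nz Y : F Y -> Y !=set0 -> [/\ T `<=` Y, theory Y & ~ Y Bot].
    by move=> FY [B YB]; case: (FP _ FY) => // Y0; rewrite Y0 in YB.
  have [TX thX _] := nz _ FX X0.
  right; split=> [A TA||[Y FY YB]].
  - by exists X => //; exact: TX.
  - split=> [A PA|A B [Y FY YAB] [Z FZ ZA]]; first by exists X => //; exact: thX.1.
    have [YZ|ZY] := Ftot _ _ FY FZ.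
    + have [_ thZ _] := nz _ FZ (ex_intro _ _ ZA).
      by exists Z => //; apply: thZ.2 ZA; exact: YZ.
    + have [_ thY _] := nz _ FY (ex_intro _ _ YAB).
      by exists Y => //; apply: (thY.2 _ _ YAB); exact: ZY.
  - by have [_ _] := nz _ FY (ex_intro _ _ YB); exact.
have [TM thM cM] : [/\ T `<=` M, theory M & ~ M Bot].
  case: PM => // M0; exfalso; apply: (Mmax T); last by right; split.
  split; first by rewrite M0.
  by move=> /(_ (Imp Bot Bot)); rewrite M0; apply; apply: thT.1; PF_tauto.
exists M => //; split=> // A nA; apply: contrapT => nNA.
have MA : M `<=` [set B | M (Imp A B)].
  by move=> B MB /=; apply: (theory_rule1 thM _ MB); PF_tauto.
(* This larger theory is consistent because [Neg A] unfolds to [Imp A Bot], which is not in [M]. *)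
apply: (Mmax [set B | M (Imp A B)]).
  split=> // /(_ A) /=; apply/not_implyP; split=> //.
  by apply: thM.1; PF_tauto.
by right; split=> // [B /TM /MA //|]; exact: theory_adjoin.
Qed.

(* Loeb's axiom applied to [A /\ BoxP A]. *)
Lemma PF_BoxP_4 A : PF (Imp (BoxP A) (BoxP (BoxP A))).
Proof.
pose C := Neg (Imp A (Neg (BoxP A))).
have mono D E : PF (Imp D E) -> PF (Imp (BoxP D) (BoxP E)).
  by move=> DE; exact: PF_MP (PF_P_K _ _) (PF_NecP DE).
have trans D E G : PF (Imp D E) -> PF (Imp E G) -> PF (Imp D G).
  move=> DE EG; by apply: PF_MP DE; apply: PF_MP EG; PF_tauto.
have CA : PF (Imp C A) by PF_tauto.
have CB : PF (Imp C (BoxP A)) by PF_tauto.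
apply: (trans _ _ _ _ (mono _ _ CB)); apply: (trans _ _ _ _ (PF_P_Loeb C)).
apply: (mono).
by apply: PF_MP (mono _ _ CA); rewrite /C; PF_tauto.
Qed.

(** * Canonical relations: existence of successors and directedness *)

Section MaximalConsistent.
Implicit Types S T : set form.

Lemma mct_imp T A B : mct T -> T (Imp A B) <-> (T A -> T B).
Proof.
move=> [thT _ mT]; split=> [|AB]; first exact: thT.2.
have [/AB|/mT] := pselect (T A); apply: theory_rule1 => //; PF_tauto.
Qed.

Lemma mct_neg T A : mct T -> T (Neg A) <-> ~ T A.
Proof.
move=> [thT cT mT]; split; last exact: mT.
by move=> NA TA; apply: cT; exact: thT.2 NA TA.
Qed.

Lemma stepF_BoxF S T A : mct S -> stepF S T -> S (BoxF A) -> T (BoxF A).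
Proof. by move=> [thS _ _] ST SA; apply/ST/(theory_rule1 thS _ SA)/PF_F_4. Qed.

Lemma stepF_trans S T U : mct S -> stepF S T -> stepF T U -> stepF S U.
Proof. by move=> mS ST TU A SA; apply: TU; exact: stepF_BoxF SA. Qed.

Lemma stepF_refl S : mct S -> stepF S S.
Proof. by move=> [thS _ _] A; apply: theory_rule1 => //; exact: PF_F_T. Qed.

(** [PF_BoxP_FP] carries [BoxP A] upwards along [stepF], and [PF_DiaP_FP] does the same for its
    negation. *)
Lemma stepF_BoxP S T A : mct S -> mct T -> stepF S T ->
  T (BoxP A) <-> S (BoxP A).
Proof.
move=> mS mT ST; have [thS _ _] := mS; have [thT cT _] := mT.
split=> [TA|SA]; last first.
  by apply/ST/(theory_rule1 thS _ SA)/PF_BoxP_FP.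
apply: contrapT => /(mct_neg _ mS) SA.
have SD : S (DiaP (Neg A)).
  apply: (theory_rule1 thS _ SA); rewrite /DiaP.
  have NN : PF (Imp (BoxP (Neg (Neg A))) (BoxP A)).
    by apply: PF_MP (PF_P_K _ _) (PF_NecP _); PF_tauto.
  by apply: PF_MP NN; PF_tauto.
have : T (DiaP (Neg A)) by apply/ST/(theory_rule1 thS _ SD)/PF_DiaP_FP.
move=> /(mct_neg _ mT); apply; apply: (theory_rule1 thT _ TA).
by apply: PF_MP (PF_P_K _ _) (PF_NecP _); PF_tauto.
Qed.

Lemma mct_not_BoxF S A : mct S -> ~ S (BoxF A) ->
  exists T, [/\ mct T, stepF S T & ~ T A].
Proof.
move=> [thS cS mS] nA.
have thF := theory_unboxF thS.
have [|T mT ST] := lindenbaum (theory_adjoin thF (Neg A)).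
  by move=> /= H; apply: nA; apply: (theory_rule1 thF _ H); PF_tauto.
exists T; split=> // [B SB|].
  by apply: ST => /=; apply: (theory_rule1 thF _ SB); PF_tauto.
by apply/(mct_neg _ mT); apply: ST => /=; apply: thF.1; PF_tauto.
Qed.

(** If no such [T] were consistent, [S] would contain [BoxP (Imp (BoxP A) A)], hence [BoxP A] by
    Loeb's axiom. Having [BoxP A] in [T] but not in [S] later makes the step strict. *)
Lemma mct_not_BoxP S A : mct S -> ~ S (BoxP A) ->
  exists T, [/\ mct T, T (BoxP A), ~ T A &
    forall B, S (BoxP B) -> T (BoxP B) /\ T (BoxF B)].
Proof.
move=> [thS cS mS] nA.
have thP := theory_unboxP thS.
have thA := theory_adjoin thP (BoxP A).
have [|T mT ST] := lindenbaum (theory_adjoin thA (Neg A)).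
  move=> /= H; apply: nA; apply: (theory_rule1 thS (PF_P_Loeb A)).
  by apply: (theory_rule1 thP _ H); PF_tauto.
have ST' B : S (BoxP B) -> T B.
  by move=> SB; apply: ST => /=; apply: (theory_rule1 thP _ SB); PF_tauto.
exists T; split=> //.
- by apply: ST => /=; apply: thP.1; PF_tauto.
- by apply/(mct_neg _ mT); apply: ST => /=; apply: thP.1; PF_tauto.
- move=> B SB; split; apply: ST'; apply: (theory_rule1 thS _ SB).
    exact: PF_BoxP_4.
  exact: PF_BoxP_PF.
Qed.

Lemma stepF_directed S T U : mct S -> mct T -> mct U -> stepF S T -> stepF S U ->
  exists V, [/\ mct V, stepF T V & stepF U V].
Proof.
move=> mS mT mU ST SU.
have [[thS _ _] [thT _ _] [thU cU _]] := And3 mS mT mU.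
have fT := theory_unboxF thT; have fU := theory_unboxF thU.
(* [J] is generated by the unboxed parts of [T] and [U]. One [C] suffices because the unboxed part
   of [T] is closed under conjunction. If [J] were inconsistent, [BoxF C] in [T] and axiom (.2) in
   [S] would put [DiaF C] in [U], against [BoxF (Neg C)]. *)
pose J := [set D | exists2 C, T (BoxF C) & U (BoxF (Imp C D))].
have thJ : theory J.
  split=> [D PD|D E [C TC UC] [C' TC' UC']].
    exists (Imp Bot Bot); first by apply: fT.1; PF_tauto.
    by apply: (theory_rule1 fU _ (fU.1 _ PD)); PF_tauto.
  exists (Neg (Imp C (Neg C'))).
    by apply: (theory_rule2 fT _ TC TC'); PF_tauto.
  by apply: (theory_rule2 fU _ UC UC'); PF_tauto.
have [|V mV JV] := lindenbaum thJ.
  move=> [C TC UC].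
  have SD : S (DiaF (BoxF C)).
    apply/(mct_neg _ mS) => /ST /(mct_neg _ mT); exact.
  have := SU _ (theory_rule1 thS (PF_F_2 C) SD).
  by move=> /(mct_neg _ mU); exact.
exists V; split=> // A HA; apply: JV.
  by exists A => //; apply: fU.1; PF_tauto.
exists (Imp Bot Bot); first by apply: fT.1; PF_tauto.
by apply: (theory_rule1 fU _ HA); PF_tauto.
Qed.

End MaximalConsistent.

(** * Frames of Boolean clusters *)

Section BooleanFrame.
Variables (C W : finType) (lt : rel C) (c0 : C) (w0 : W).
Hypotheses (lt_irr : irreflexive lt) (lt_trans : transitive lt).
Hypothesis c0_min : forall c, c = c0 \/ lt c0 c.

(** A world is a cluster index, a point of the powerset algebra of [W], and a label. The relations
    ignore the label, which only multiplies the points of each [approx] class. *)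
Definition boolean_frame : frame :=
  @Frame (C * {set W} * W)%type
    (fun p q => lt p.1.1 q.1.1)
    (fun p q => p.1.1 = q.1.1 /\ p.1.2 \subset q.1.2)
    (inhabits (c0, finset.set0, w0)).

Local Notation world := (world boolean_frame).
Implicit Types p q : world.

(** Induction along the converse of [lt]: passing to a successor strictly shrinks the finite set of
    successors. *)
Let lt_ind (P : C -> Prop) :
  (forall c, (forall c', lt c c' -> P c') -> P c) -> forall c, P c.
Proof.
move=> IH c; have [n] := ubnP #|[set c' | lt c c']%SET|.
elim: n c => // n IHn c cn; apply: IH => c' cc'; apply: IHn.
rewrite -ltnS; apply: leq_trans cn; rewrite ltnS; apply: proper_card.
apply/fintype.properP; split; last by exists c'; rewrite !inE ?lt_irr.
by apply/fintype.subsetP => d; rewrite !inE; exact: lt_trans.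
Qed.

Lemma boolean_frame_PF : PF_frame boolean_frame.
Proof.
move=> A; elim=> {A}.
- move=> A tA V p; pose v B := `[< forces V p B >].
  have E B : prop_eval v B <-> forces V p B.
    elim: B => [n||B IHB D IHD|B _|B _] //=; try by split=> /asboolP.
    rewrite -IHB -IHD; split=> [/implyP//|H]; exact/implyP.
  exact/E/tA.
- by move=> A B V p /= AB HA q pq; apply: AB => //; exact: HA.
- move=> A V p /= HL q pq.
  have H c : lt p.1.1 c -> forall q, q.1.1 = c -> forces V q A.
    elim/lt_ind: c => c IH pc q' q'c; apply: HL => [|s qs]; first by rewrite q'c.
    have cs : lt c s.1.1 by rewrite -q'c.
    exact: IH cs (lt_trans pc cs) s erefl.
  exact: H pq _ _.
- by move=> A B V p /= AB HA q pq; apply: AB => //; exact: HA.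
- by move=> A V p /=; apply; split.
- move=> A V p /= HA q [pq pq'] s [qs qs']; apply: HA.
  by rewrite pq qs; split=> //; exact: fintype.subset_trans pq' qs'.
- move=> A V p /= H q [pq _] NA; apply: H => s [ps _] HA.
  (* The full subset gives a common upper bound of [q] and [s]. *)
  apply: (NA (s.1.1, finset.setT, s.2)); first by rewrite -pq -ps; split=> //=.
  by apply: HA; split=> //=.
- by move=> A V p /= HA q [pq _] s qs; apply: HA; rewrite pq.
- by move=> A V p /= HA q [pq _] NA; apply: HA => s; rewrite pq; exact: NA.
- by move=> A V p /= HA q pq s [qs _]; apply: HA; rewrite -qs.
- by move=> A B _ IAB _ IA V p; apply: IAB; exact: IA.
- by move=> A _ IA V p q _; exact: IA.
- by move=> A _ IA V p q _; exact: IA.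
Qed.

Lemma boolean_frame_nice : nice boolean_frame.
Proof. by move=> p q s /= ps [-> _]. Qed.

Lemma boolean_frame_cluster p : cluster p = [set q | p.1.1 = q.1.1].
Proof.
apply/seteqP; split=> q /=.
  by elim=> {p q} [p q [[->]|[->]]//|p q s _ -> _ ->].
(* Two points with the same index are linked through a top of their cluster. *)
move=> pq; apply: (@t_trans _ _ _ (p.1.1, finset.setT, p.2)); apply: t_step.
  by left; split=> //=.
by right; split=> //=.
Qed.

Lemma boolean_frame_root_element p :
  root_element (cluster p) (p.1.1, finset.set0, p.2).
Proof.
rewrite boolean_frame_cluster; split=> // q /= pq.
by split=> //=; exact: finset.sub0set.
Qed.

Lemma boolean_frame_root_cluster :
  root_cluster (cluster ((c0, finset.set0, w0) : world)).
Proof.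
split=> [|D [q ->]]; first by eexists; reflexivity.
have [q0|c0q] := c0_min q.1.1; [left|right].
  by rewrite !boolean_frame_cluster q0.
by exists (c0, finset.set0, w0), q.
Qed.

Lemma boolean_frame_PBA : PBA boolean_frame.
Proof.
move=> K [p ->]; rewrite boolean_frame_cluster.
set K0 : set world := (X in pre_boolean_algebra X).
have acE q : K0 q -> approx_class K0 q = [set s | s.1 = q.1].
  move=> /= pq; apply/seteqP; split=> s /=.
    move=> [_ [[E1 S1] [_ S2]]]; move: E1 S1 S2.
    case: s q {pq} => [[a X] u] [[b Y] v] /= -> XY YX.
    by congr pair; apply/eqP; rewrite finset.eqEsubset XY YX.
  by case: s q pq => [[a X] u] [[b Y] v] /= pb [-> ->]; do !split.
(* The members of an [approx] class share their subset, so the union over the class recovers it. *)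
pose f (S : set world) : {set W} :=
    [set w | `[< exists2 q, S q & w \in q.1.2 >]]%SET.
have fE q : K0 q -> f (approx_class K0 q) = q.1.2.
  move=> Kq; rewrite acE //; apply/finset.setP => w; rewrite inE.
  by apply/asboolP/idP => [[s /= ->]//|wq]; exists q.
exists _, ({set W} : ctbDistrLatticeType _), f; split.
  split=> [//|_ _ /set_mem[q Kq <-] /set_mem[s Ks <-]|X _].
    rewrite !fE // !acE // => qs; apply/funext => v /=.
    by rewrite [q.1]surjective_pairing [s.1]surjective_pairing qs -Kq -Ks.
  exists (approx_class K0 (p.1.1, X, p.2)); last by rewrite fE.
  by exists (p.1.1, X, p.2).
move=> _ _ [q Kq <-] [s Ks <-]; rewrite !fE // !acE //; split.
  by move=> [q' [s' [/= E1 E2 [_]]]]; rewrite E1 E2.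
by move=> qs; exists q, s; split=> //; split=> //; rewrite -Kq -Ks.
Qed.

Lemma boolean_frameP : finite_rooted_nice_PBA_PF_frame boolean_frame.
Proof.
split.
- exact: boolean_frame_PF.
- exact: (@finite_finset (C * {set W} * W)%type).
- exact: boolean_frame_nice.
- split; first by eexists; exact: boolean_frame_root_cluster.
  by move=> _ [p ->]; eexists; exact: boolean_frame_root_element.
- exact: boolean_frame_PBA.
Qed.

End BooleanFrame.

(** * Finite models from maximal consistent theories *)

(* The extra formula [BoxF B] for [BoxP B] is what propagates [B] from the root
   of a cluster to the whole cluster in the truth lemma. *)
Fixpoint closure (A : form) : seq form :=
  match A with
  | Imp B C => A :: closure B ++ closure C
  | BoxP B => A :: BoxF B :: closure B
  | BoxF B => A :: closure B
  | _ => [:: A]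
  end.

Lemma closure_refl A : A \in closure A.
Proof. by case: A => *; rewrite inE eqxx. Qed.

Lemma closure_trans A B : B \in closure A -> {subset closure B <= closure A}.
Proof.
elim: A => [n||A1 IH1 A2 IH2|A IH|A IH] /=.
- by rewrite inE => /eqP ->.
- by rewrite inE => /eqP ->.
- rewrite inE mem_cat => /or3P[/eqP->//|/IH1 H|/IH2 H] D /H;
    by rewrite inE mem_cat => ->; rewrite ?orbT.
- rewrite !inE => /or3P[/eqP->//|/eqP->|/IH H] D.
    by rewrite /= !inE => /orP[->|->]; rewrite ?orbT.
  by move=> /H; rewrite !inE => ->; rewrite !orbT.
- rewrite inE => /orP[/eqP->//|/IH H] D /H.
  by rewrite inE => ->; rewrite orbT.
Qed.

(** An element of [W] is a set of positions in [s]. If it is the trace of a maximal consistent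
    theory, [th] picks one with that trace; otherwise it takes [T0]. *)
Lemma finite_mct_quotient (s : seq form) (T0 : set form) : mct T0 ->
  exists (W : finType) (th : W -> set form), (forall w, mct (th w)) /\
    forall T, mct T -> exists w, forall B, B \in s -> th w B <-> T B.
Proof.
move=> mT0.
pose tp (T : set form) : {set 'I_(size s)} :=
  [set i : 'I_(size s) | `[< T (nth Bot s i) >]]%SET.
have thP (w : {set 'I_(size s)}) : exists T, mct T /\
    ((exists2 T', mct T' & tp T' = w) -> tp T = w).
  have [[T mT Tw]|no] := pselect (exists2 T', mct T' & tp T' = w).
    by exists T; split.
  by exists T0; split.
have [th thE] := choice thP; exists {set 'I_(size s)}, th.
split=> [w|T mT]; first by case: (thE w).
exists (tp T) => B Bs.
have /finset.setP : tp (th (tp T)) = tp T by apply: (thE (tp T)).2; exists T.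
have Bi : (index B s < size s)%N by rewrite index_mem.
move=> /(_ (Ordinal Bi)); rewrite !inE /= nth_index // => E.
by split=> /asboolP; rewrite ?E => H; apply/asboolP; rewrite -?E // E.
Qed.

(** * The orders on traces and the truth lemma *)

Section Completeness.
Variables (S : seq form) (W : finType) (th : W -> set form) (c0 : W).
Hypothesis S_closed : forall A, A \in S -> {subset closure A <= S}.
Hypothesis mct_th : forall w, mct (th w).
Hypothesis th_onto :
  forall T, mct T -> exists w, forall B, B \in S -> th w B <-> T B.

(** Requiring [BoxF B] at [d] makes [B] hold throughout the cluster of [d]. The second clause gives
    irreflexivity. *)
Let ltW : rel W := fun c d =>
  `[< (forall B, BoxP B \in S -> th c (BoxP B) -> th d (BoxP B) /\ th d (BoxF B))
    /\ exists2 B, BoxP B \in S & th d (BoxP B) /\ ~ th c (BoxP B) >].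

Let ltW_irr : irreflexive ltW.
Proof. by move=> c; apply/asboolP => -[_ [B _ []]]. Qed.

Let ltW_trans : transitive ltW.
Proof.
move=> d c e /asboolP[cd [B BS [dB cB]]] /asboolP[de _]; apply/asboolP.
split=> [D DS /(cd _ DS)[/(de _ DS)]//|].
by exists B => //; split=> //; have [] := de _ BS dB.
Qed.

(** The transitive filtration of [stepF]: comparing boxed formulas with boxed formulas makes it a
    preorder, and axiom T recovers [B] from [BoxF B]. *)
Let leW : rel W := fun w v =>
  `[< forall B, BoxF B \in S -> th w (BoxF B) -> th v (BoxF B) >].

Let above (c w : W) : Prop := exists T,
  [/\ mct T, stepF (th c) T & forall B, B \in S -> th w B <-> T B].

Let leW_refl : reflexive leW.
Proof. by move=> w; apply/asboolP. Qed.

Let leW_trans : transitive leW.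
Proof.
move=> v w u /asboolP wv /asboolP vu; apply/asboolP => B BS.
by move=> /(wv _ BS)/(vu _ BS).
Qed.

Let above_refl c : above c c.
Proof. by exists (th c); split=> //; exact: stepF_refl. Qed.

Let above_le c w : above c w -> leW c w.
Proof.
move=> [T [mT cT wT]]; apply/asboolP => B BS cB.
by apply/(wT _ BS); exact: stepF_BoxF cB.
Qed.

Let above_BoxP c w B : BoxP B \in S -> above c w ->
  th w (BoxP B) <-> th c (BoxP B).
Proof. by move=> BS [T [mT cT wT]]; rewrite wT // (stepF_BoxP B _ mT cT). Qed.

(** Running through the finitely many traces, [stepF_directed] absorbs them one by one into a single
    theory, whose trace is the top. *)
Let above_top c : exists2 t, above c t & forall w, above c w -> leW w t.
Proof.
have [T [mT cT H]] : exists T, [/\ mct T, stepF (th c) T &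
    forall w, w \in enum W -> above c w ->
      forall B, BoxF B \in S -> th w (BoxF B) -> T (BoxF B)].
  elim: (enum W) => [|w s [T [mT cT H]]].
    by exists (th c); split=> //; exact: stepF_refl.
  have [[U [mU cU wU]]|nw] := pselect (above c w); last first.
    exists T; split=> // v; rewrite inE => /orP[/eqP-> //|]; exact: H.
  have [V [mV TV UV]] := stepF_directed (mct_th c) mT mU cT cU.
  exists V; split=> //; first exact: stepF_trans TV.
  move=> v; rewrite inE => /orP[/eqP-> _|vs av] B BS vB.
    by apply: (stepF_BoxF mU UV); apply/wU.
  by apply: (stepF_BoxF mT TV); exact: H vB.
have [t tT] := th_onto mT.
exists t; first by exists T.
move=> w aw; apply/asboolP => B BS wB.
by apply/tT => //; apply: (H w) => //; rewrite mem_enum.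
Qed.

Let cover c : exists f : {set W} -> W -> W,
  [/\ forall X u, above c (f X u),
      forall (X Y : {set W}) u v, X \subset Y -> leW (f X u) (f Y v),
      forall X u v, above c v -> leW (f X u) v ->
        exists2 Y : {set W}, X \subset Y & f Y v = v
    & f finset.set0 c = c].
Proof.
have [t ct le_t] := above_top c.
pose D := [set w | `[< above c w >]]%SET.
have DE w : (w \in D) = `[< above c w >] by rewrite inE.
have [||||f [f1 f2 f3 f4]] := @preorder_cover W leW D c t leW_refl leW_trans.
- by rewrite DE; apply/asboolP.
- by rewrite DE; apply/asboolP.
- by move=> w; rewrite DE => /asboolP; exact: above_le.
- by move=> w; rewrite DE => /asboolP; exact: le_t.
exists f; split=> // [X u|X u v av].
  by have := f1 X u; rewrite DE => /asboolP.
by apply: f3; rewrite DE; apply/asboolP.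
Qed.

(** The part generated by [c0] is kept, so that [c0] indexes the root cluster. *)
Let root_set := [pred c | (c == c0) || ltW c0 c].

Let idx := {c | root_set c}.

Lemma finite_model : exists (F : frame) (V : valuation F),
  finite_rooted_nice_PBA_PF_frame F /\
  exists C x, [/\ root_cluster C, root_element C x &
    forall B, B \in S -> forces V x B <-> th c0 B].
Proof.
have [f fP] := choice cover.
have idx0 : root_set c0 by rewrite /= eqxx.
pose lt : rel idx := fun c d => ltW (val c) (val d).
have lt_irr : irreflexive lt by move=> c; exact: ltW_irr.
have lt_trans : transitive lt by move=> d c e; exact: ltW_trans.
pose i0 : idx := exist _ c0 idx0.
have i0_min c : c = i0 \/ lt i0 c.
  by case: c => c cP; case/orP: (cP) => [/eqP c_0|]; [left; exact: val_inj|right].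
pose F := boolean_frame lt i0 c0.
(* On each cluster [val_of] is the covering map onto the traces [above] its index. *)
pose val_of (p : world F) := f (val p.1.1) p.1.2 p.2.
pose V : valuation F := fun n p => th (val_of p) (Var n).
have truth B : B \in S -> forall p : world F, forces V p B <-> th (val_of p) B.
  elim: B => [n||B IHB D IHD|B IHB|B IHB] BS p.
  - by [].
  - by split=> //; case: (mct_th (val_of p)).
  - have [BS' DS'] : B \in S /\ D \in S.
      by split; apply: (S_closed BS); rewrite /= inE mem_cat closure_refl !orbT.
    by rewrite (mct_imp _ _ (mct_th _)) /= IHB // IHD.
  - have [BS' FS'] : B \in S /\ BoxF B \in S.
      by split; apply: (S_closed BS); rewrite /= !inE ?closure_refl ?eqxx ?orbT.
    have [fa _ _ _] := fP (val p.1.1).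
    rewrite (above_BoxP BS (fa p.1.2 p.2)); split=> [H|H q pq].
      apply: contrapT => nB.
      have [T [mT TB nTB TS]] := mct_not_BoxP (mct_th _) nB.
      have [d dT] := th_onto mT.
      have pd : ltW (val p.1.1) d.
        apply/asboolP; split=> [D DS /TS[TD TD']|].
          split; apply/dT => //; apply: (S_closed DS).
          by rewrite /= !inE eqxx orbT.
        by exists B => //; split=> //; apply/dT.
      have rd : root_set d.
        apply/orP; right; have [E|H0] := i0_min p.1.1.
          by move: pd; rewrite E.
        exact: ltW_trans H0 pd.
      (* At the empty subset with label [d], the covering map takes the value [d], where [B]
         fails. *)
      pose q : world F := (exist _ d rd, finset.set0, d).
      have /(IHB BS') := H q pd; rewrite /val_of /q /=.
      by have [_ _ _ ->] := fP d; rewrite dT.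
    (* [BoxF B] holds at the index of [q], hence [B] holds in every theory [stepF]-above it. *)
    have [/(_ _ BS H)[_ qB] _] := asboolW pq.
    apply/IHB => //; have [ga _ _ _] := fP (val q.1.1).
    have [T [mT cT wT]] := ga q.1.2 q.2.
    by apply/wT => //; exact: cT.
  - have BS' : B \in S by apply: (S_closed BS); rewrite /= inE closure_refl orbT.
    have [fa fm fb _] := fP (val p.1.1).
    split=> [H|H q [pq pq']]; last first.
      have := fm _ _ p.2 q.2 pq' => /asboolP/(_ _ BS H).
      move=> /(stepF_refl (mct_th _)) qB; apply/(IHB BS').
      by rewrite /val_of -pq.
    apply: contrapT => nB; have [T [mT cT wT]] := fa p.1.2 p.2.
    have [U [mU TU nU]] : exists U, [/\ mct U, stepF T U & ~ U B].
      by apply: mct_not_BoxF => //; rewrite -wT.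
    have [v vU] := th_onto mU.
    have av : above (val p.1.1) v.
      by exists U; split=> //; exact: stepF_trans TU.
    have pv : leW (val_of p) v.
      apply/asboolP => D DS pD; apply/vU => //; apply: (stepF_BoxF mT TU).
      exact/wT.
    (* The back condition of the cover lifts [v] to a point of the frame above [p]. *)
    have [Y pY fY] := fb _ _ _ av pv.
    have /(IHB BS') := H (p.1.1, Y, v) (conj erefl pY).
    by rewrite /val_of /= fY vU.
exists F, V; split; first exact: boolean_frameP.
exists (cluster ((i0, finset.set0, c0) : world F)), (i0, finset.set0, c0); split.
- exact: boolean_frame_root_cluster.
- exact: boolean_frame_root_element.
- move=> B BS; rewrite truth // /val_of /=.
  by have [_ _ _ ->] := fP c0.
Qed.

End Completeness.

Theorem theorem4p7 (A : form) :
  [<-> PF A;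
       forall F : frame, PF_frame F -> valid F A;
       forall F : frame, finite_rooted_nice_PBA_PF_frame F -> valid F A;
       forall (F : frame) (V : valuation F),
         finite_rooted_nice_PBA_PF_frame F ->
         forall (C : set (world F)) (x : world F),
           root_cluster C -> root_element C x -> forces V x A].
Proof.
tfae.
- by move=> PA F; exact.
- by move=> H F [FP _ _ _ _]; exact: H.
- by move=> H F V FP C x _ _; exact: H.
move=> H; apply: contrapT => nA.
have thPF : theory PF by split=> // B C; exact: PF_MP.
have [|T mT TA] := lindenbaum (theory_adjoin thPF (Neg A)).
  by move=> /= NNA; apply: nA; apply: (theory_rule1 thPF _ NNA); PF_tauto.
have [W [th [mth onto]]] := finite_mct_quotient (closure A) mT.
have [c0 c0T] := onto _ mT.
have [F [V [FP [C [x [Cr xr xE]]]]]] :=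
  finite_model c0 (@closure_trans A) mth onto.
have /xE := H F V FP C x Cr xr; rewrite c0T ?closure_refl // => /(_ isT).
by apply/(mct_neg _ mT)/TA => /=; apply: thPF.1; PF_tauto.
Qed.
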